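(* Let $n\ge1$, $\tau\in(-\frac{\pi}{4},0)$, $a=\cot\tau$ and $b=\sqrt{\cot^2\tau-1}$. Then there exist smooth functions $u:\mathbb{R}^n\to\mathbb{R}$ that are not quadratic polynomials, satisfy $$-(b+a)I<D^2u(x)<(b-a)I\qquad\text{for all }x\in\mathbb{R}^n,$$ and solve $$\frac{\sqrt{a^2+1}}{2b}\sum_{i=1}^n\ln\frac{b+a+\lambda_i}{b-a-\lambda_i}=-u+\frac12\langle x,Du\rangle\qquad\text{on }\mathbb{R}^n,$$ where $\lambda_1,\dots,\lambda_n$ are the eigenvalues of $D^2u(x)$. That is, this equation admits entire smooth non-quadratic admissible solutions.
   Context: $\langle\cdot,\cdot\rangle$ is the standard inner product on $\mathbb{R}^n$, $Du$ is the gradient, $I$ is the identity matrix, and inequalities between symmetric matrices are in the sense of quadratic forms. A solution of this equation is called admissible if $-(b+a)I<D^2u<(b-a)I$ everywhere on its domain. ''Quadratic polynomial'' means a polynomial of degree at most $2$. *)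

(* Defs.v *)
From HB Require Import structures.
From mathcomp Require Import all_boot all_order all_algebra.
From mathcomp Require Import all_classical all_reals all_analysis.
(* The notations of mpoly clash with those of MathComp-Analysis. *)
From mathcomp Require Import -(notations) mpoly.

Set Implicit Arguments.
Unset Strict Implicit.
Unset Printing Implicit Defensive.

Import Order.TTheory GRing.Theory Num.Theory.
Import numFieldNormedType.Exports.

Local Open Scope ring_scope.

Definition cot (R : realType) (t : R) : R := cos t / sin t.

(* Vectors of R^n are rows; the library's norm on 'rV[R]_n is the sup norm,
   which is used only for its (Euclidean) topology. *)
Definition dotv (R : realType) (n : nat) (v w : 'rV[R]_n) : R :=
  \sum_(i < n) v 0 i * w 0 i.

Definition partial (R : realType) (n : nat) (i : 'I_n) (u : 'rV[R]_n -> R) :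
    'rV[R]_n -> R :=
  fun x => 'D_('e_i) u x.

Definition partials (R : realType) (n : nat) (s : seq 'I_n)
    (u : 'rV[R]_n -> R) : 'rV[R]_n -> R :=
  foldr (@partial R n) u s.

(* C^oo on R^n: all iterated partial derivatives exist and are continuous. The
   existence clause is needed because 'D is a total operator. *)
Definition smooth (R : realType) (n : nat) (u : 'rV[R]_n -> R) : Prop :=
  forall s : seq 'I_n,
    continuous (partials s u) /\
    forall (i : 'I_n) (x : 'rV[R]_n), derivable (partials s u) x 'e_i.

Definition gradient (R : realType) (n : nat) (u : 'rV[R]_n -> R)
    (x : 'rV[R]_n) : 'rV[R]_n :=
  \row_i partial i u x.

Definition hessian (R : realType) (n : nat) (u : 'rV[R]_n -> R)
    (x : 'rV[R]_n) : 'M[R]_n :=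
  \matrix_(i, j) partial i (partial j u) x.

Definition qform_lt (R : realType) (n : nat) (A B : 'M[R]_n) : Prop :=
  forall v : 'rV[R]_n, v != 0 -> dotv (v *m A) v < dotv (v *m B) v.

Definition admissible (R : realType) (n : nat) (a b : R)
    (u : 'rV[R]_n -> R) : Prop :=
  forall x : 'rV[R]_n,
    qform_lt (- (b + a))%:M (hessian u x) /\ qform_lt (hessian u x) (b - a)%:M.

(* lam lists the eigenvalues of A with algebraic multiplicity; it is determined
   by A up to permutation. *)
Definition eigenvalues_of (R : realType) (n : nat) (A : 'M[R]_n)
    (lam : 'I_n -> R) : Prop :=
  char_poly A = \prod_(i < n) ('X - (lam i)%:P).

Definition solves (R : realType) (n : nat) (a b : R)
    (u : 'rV[R]_n -> R) : Prop :=
  forall x : 'rV[R]_n,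
    exists2 lam : 'I_n -> R, eigenvalues_of (hessian u x) lam &
      Num.sqrt (a ^+ 2 + 1) / (2 * b) *
        \sum_(i < n) ln ((b + a + lam i) / (b - a - lam i))
      = - u x + 2^-1 * dotv x (gradient u x).

(* Total degree at most 2: mmeasure mdeg p (the library's msize p) is the total
   degree of p plus one, and 0 if p = 0. *)
Definition quadratic_polynomial (R : realType) (n : nat)
    (u : 'rV[R]_n -> R) : Prop :=
  exists2 p : mpoly n R,
    (mmeasure mdeg p <= 3)%N & forall x : 'rV[R]_n, u x = meval (x 0) p.

(* Main.v *)
Require Import Defs.
From HB Require Import structures.
From mathcomp Require Import all_boot all_order all_algebra.
From mathcomp Require Import all_classical all_reals all_analysis.
From mathcomp Require Import ring lra.
From mathcomp Require Import -(notations) mpoly.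
Import Order.TTheory GRing.Theory Num.Theory.
Import numFieldNormedType.Exports.
Local Open Scope classical_set_scope.
Local Open Scope ring_scope.

Set Implicit Arguments.
Unset Strict Implicit.
Unset Printing Implicit Defensive.

(* The equation separates: if v solves it for n = 1, then
   u(x) = v(x_1) + ... + v(x_n) solves it in dimension n. For n = 1, inverting
   the logarithm turns the equation into v'' = G(x v' / 2 - v), where G is an
   affine function of the logistic function with values in (-(b + a), b - a).
   As G is bounded and Lipschitz, Picard iteration in a norm with weight
   exp(L x^2) converges on the whole line, for any v(0) and v'(0). Take v(0) = 0
   and v'(0) = 1. If v were quadratic, then v'' and hence x v' / 2 - v would be
   constant, but the derivative of the latter at 0 is - v'(0) / 2. *)

(** * Differentiation on the whole line *)

Definition has_deriv (R : realType) (f f' : R -> R) : Prop :=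
  forall x : R, is_derive x 1 f (f' x).

Section HasDeriv.
Variable R : realType.
Implicit Types f g : R -> R.

Lemma has_deriv_continuous f f' : has_deriv f f' -> continuous f.
Proof.
move=> df x; apply/differentiable_continuous/derivable1_diffP.
by have [] := df x.
Qed.

Lemma has_deriv_cst (c : R) : has_deriv (fun=> c) (fun=> 0).
Proof. by move=> x; exact: is_derive_cst. Qed.

Lemma has_deriv_id : has_deriv (fun x : R => x) (fun=> 1).
Proof. by move=> x; exact: is_derive_id. Qed.

Lemma has_derivD f f' g g' : has_deriv f f' -> has_deriv g g' ->
  has_deriv (fun x => f x + g x) (fun x => f' x + g' x).
Proof. by move=> df dg x; exact: is_deriveD. Qed.

Lemma has_derivB f f' g g' : has_deriv f f' -> has_deriv g g' ->
  has_deriv (fun x => f x - g x) (fun x => f' x - g' x).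
Proof. by move=> df dg x; exact: is_deriveB. Qed.

Lemma has_derivM f f' g g' : has_deriv f f' -> has_deriv g g' ->
  has_deriv (fun x => f x * g x) (fun x => f' x * g x + f x * g' x).
Proof.
move=> df dg x; apply: is_derive_eq; first exact: is_deriveM.
by rewrite addrC /GRing.scale /= [g x * _]mulrC.
Qed.

Lemma has_deriv_comp f f' g g' : has_deriv f f' -> has_deriv g g' ->
  has_deriv (fun x => f (g x)) (fun x => f' (g x) * g' x).
Proof. by move=> df dg x; exact: is_derive1_comp. Qed.

Lemma has_deriv_unique f f' f'' : has_deriv f f' -> has_deriv f f'' ->
  f' =1 f''.
Proof. by move=> df df' x; have [_ <-] := df x; have [_ <-] := df' x. Qed.

Lemma has_deriv_eq {f f'} g g' : has_deriv f f' -> f =1 g -> f' =1 g' ->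
  has_deriv g g'.
Proof. by move=> df /funext <- /funext <-. Qed.

Lemma has_deriv_MVT f f' (x y : R) : has_deriv f f' -> x <= y ->
  exists2 c, x <= c <= y & f y - f x = f' c * (y - x).
Proof.
move=> df xy.
have [|c] := @MVT_segment R f f' x y xy (fun z _ => df z).
  exact/continuous_subspaceT/has_deriv_continuous/df.
by rewrite in_itv /= => cxy e; exists c.
Qed.

(** The mean value theorem on [[0, x]] for [g - f] and [g + f], whose derivatives are nonnegative
    there. The two intermediate points may differ. *)
Lemma has_deriv_norm_le f f' g g' : has_deriv f f' -> has_deriv g g' ->
  (forall x, 0 <= x -> `|f' x| <= g' x) ->
  forall x, 0 <= x -> `|f x - f 0| <= g x - g 0.
Proof.
move=> df dg le x x0; rewrite ler_norml.
have [c /andP[c0 _]] := has_deriv_MVT (has_derivB dg df) x0.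
have [d /andP[d0 _]] := has_deriv_MVT (has_derivD dg df) x0.
have := le _ c0; have := le _ d0; rewrite !ler_norml subr0.
move=> /andP[h1 h2] /andP[h3 h4] e1 e2.
have : 0 <= (g' c - f' c) * x by rewrite mulr_ge0// subr_ge0.
have : 0 <= (g' d + f' d) * x by rewrite mulr_ge0//; lra.
lra.
Qed.

Lemma lipschitz_of_deriv_le f f' (L : R) : has_deriv f f' ->
  (forall x, `|f' x| <= L) -> forall x y, `|f x - f y| <= L * `|x - y|.
Proof.
move=> df le x y; wlog yx : x y / y <= x.
  move=> H; have [/H//|/ltW/H] := leP y x.
  by rewrite distrC [`|y - x|]distrC.
have [c _ ->] := has_deriv_MVT df yx.
by rewrite normrM ler_wpM2r.
Qed.

End HasDeriv.

(** * Antiderivatives of continuous functions *)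

Section Antiderivative.
Variable R : realType.
Implicit Types f : R -> R.
Local Notation mu := (@lebesgue_measure R).

(* Vanishing on the left half-line makes f integrable on every ]-oo, x], so that
   a single lower bound serves for the fundamental theorem on all of R. *)
Lemma has_antiderivative_pos f : continuous f ->
  (forall x, x <= 0 -> f x = 0) -> exists F, has_deriv F f.
Proof.
move=> cf f0.
exists (fun x => \int[mu]_(t in [set` Interval -oo%O (BRight x)]) f t)%R => x.
have intf : mu.-integrable [set` Interval -oo%O (BRight (x + 1))] (EFin \o f).
  have -> : EFin \o f = ((EFin \o f) \_ `[0%R, +oo[)%classic.
    apply/funext => y; rewrite patchE; case: ifPn => //.
    rewrite notin_setE /= in_itv /= andbT => /negP.
    by rewrite -ltNge => /ltW/f0 ->.
  apply/integrable_restrict => //.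
  have -> : (`]-oo, x + 1] `&` `[0, +oo[ = `[0, x + 1])%classic.
    apply/seteqP; split => y; rewrite /= !in_itv /= andbT.
      by move=> [-> ->].
    by move/andP => [].
  apply: continuous_compact_integrable; first exact: segment_compact.
  exact: continuous_subspaceT.
have xx1 : x < x + 1 by rewrite ltrDl.

have [|dF dFE] := continuous_FTC1 xx1 intf _ (cf x); first by rewrite ltNyr.
by split; [exact: dF|rewrite -derive1E; exact: dFE].
Qed.

Lemma has_antiderivative f : continuous f ->
  exists F, has_deriv F f /\ F 0 = 0.
Proof.
move=> cf.
suff [F dF] : exists F, has_deriv F f.
  exists (fun x => F x - F 0); split; last by rewrite subrr.
  by apply: has_deriv_eq (has_derivB dF (has_deriv_cst (F 0))) _ _ => x;
    rewrite ?subr0.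
(* [f x = f1 x + f 0 + f2 (- x)], where [f1] and [f2] vanish on the left half-line. The reflected
   summand contributes [- F2 (- x)] to the antiderivative. *)
pose f1 x := f (Num.max x 0) - f 0.
pose f2 x := f (Num.min (- x) 0) - f 0.
have [x|x x0|F1 dF1] := @has_antiderivative_pos f1.
- apply: cvgB; last exact: cvg_cst.
  apply: (@continuous_comp _ _ _ (fun y : R => Num.max y 0)); last exact: cf.
  by apply: continuous_max; [exact: cvg_id|exact: cvg_cst].
- by rewrite /f1 max_r ?subrr.
have [x|x x0|F2 dF2] := @has_antiderivative_pos f2.
- apply: cvgB; last exact: cvg_cst.
  apply: (@continuous_comp _ _ _ (fun y : R => Num.min (- y) 0));
    last exact: cf.
  by apply: continuous_min; [exact: continuousN|exact: cvg_cst].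
- by rewrite /f2 min_r ?subrr// oppr_ge0.
exists (fun x => F1 x + f 0 * x - F2 (0 - x)).
have dl := has_derivM (has_deriv_cst (f 0)) (@has_deriv_id R).
have dr := has_deriv_comp dF2 (has_derivB (has_deriv_cst 0) (@has_deriv_id R)).
apply: has_deriv_eq (has_derivB (has_derivD dF1 dl) dr) _ _ => // x.
rewrite /f1 /f2 sub0r opprK.
have [x0|/ltW x0] := leP x 0.
  by ring.
by ring.
Qed.

(* prim f is the zero function if f has no antiderivative. *)
Definition prim f : R -> R :=
  xget (cst 0) [set F | has_deriv F f /\ F 0 = 0]%classic.

Lemma prim_deriv f : continuous f -> has_deriv (prim f) f.
Proof. by move/has_antiderivative/(xgetPex (cst 0)) => []. Qed.

Lemma prim0 f : continuous f -> prim f 0 = 0.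
Proof. by move/has_antiderivative/(xgetPex (cst 0)) => []. Qed.

End Antiderivative.

(** * Contractions in a weighted sup norm *)

Section WeightedFixpoint.
Variable R : realType.
Implicit Types f g : R -> R.

Lemma le0_of_le_geometric (c y : R) :
  (forall k, y <= c * 2^-1 ^+ k) -> y <= 0.
Proof.
move=> le.
have h : (geometric c 2^-1 : R ^nat) @ \oo --> (0 : R).
  by apply: cvg_geometric; rewrite ger0_norm// invf_lt1// ltr1n.
rewrite -(cvg_lim _ h)//; apply: limr_ge; first exact: cvgP h.
by apply: nearW => k; exact: le.
Qed.

Lemma geometric_cauchy_cvg (u : nat -> R) (c : R) :
  (forall k, `|u k.+1 - u k| <= c * 2^-1 ^+ k) ->
  exists l, forall k, `|l - u k| <= 2 * c * 2^-1 ^+ k.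
Proof.
move=> le.
(* Keeping the exact geometric sum, with its subtracted tail, lets the induction on [j] close. *)
have gap k j : `|u (k + j)%N - u k| <= 2 * c * (2^-1 ^+ k - 2^-1 ^+ (k + j)).
  elim: j => [|j IH]; first by rewrite addn0 !subrr normr0 mulr0.
  rewrite addnS exprS.
  have := ler_normD (u (k + j).+1 - u (k + j)%N) (u (k + j)%N - u k).
  rewrite addrA subrK; have := le (k + j)%N; lra.
have c0 : 0 <= c by have := le 0; rewrite expr0 mulr1; exact: le_trans.
have gap' k j : `|u (k + j)%N - u k| <= 2 * c * 2^-1 ^+ k.
  apply: (le_trans (gap k j)); rewrite ler_wpM2l ?mulr_ge0// gerBl.
  by rewrite exprn_ge0// invr_ge0.
have : cvgn u.
  apply: cauchy_cvg; apply/cauchy_exP => e e0.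
  have [k ke] : exists k, 2 * c * 2^-1 ^+ k < e.
    apply: contrapT => H.
    suff : e <= 0 by rewrite leNgt e0.
    apply: (@le0_of_le_geometric (2 * c)) => k.
    by rewrite leNgt; apply/negP => h; apply: H; exists k.
  exists (u k); exists k => // m /= km.
  by rewrite /ball /= distrC (le_lt_trans _ ke)// -(subnKC km).
move=> /cvg_ex[l ul]; exists l => k.
have h : (fun n => `|u n - u k|) @ \oo --> `|l - u k|.
  by apply: cvg_norm; apply: cvgB => //; exact: cvg_cst.
rewrite -(cvg_lim _ h)//; apply: limr_le; first exact: cvgP h.
by exists k => // m /= km; rewrite -(subnKC km).
Qed.

(** Banach's argument for the norm sup |f| / [phi] with ratio 1/2, carried out pointwise. The
    iterates converge at a rate proportional to [phi], hence locally uniformly, so the limit is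
    continuous. *)
Lemma weighted_fixpoint (phi : R -> R) (T : (R -> R) -> R -> R) f0 (c : R) :
  continuous phi -> (forall x, 0 < phi x) ->
  (forall f, continuous f -> continuous (T f)) ->
  (forall f g m, continuous f -> continuous g ->
    (forall x, `|f x - g x| <= m * phi x) ->
    forall x, `|T f x - T g x| <= m / 2 * phi x) ->
  continuous f0 -> (forall x, `|T f0 x - f0 x| <= c * phi x) ->
  exists2 f, continuous f & T f =1 f.
Proof.
move=> cphi phi0 cT contr cf0 T0.
pose u k := iter k T f0.
have cu k : continuous (u k) by elim: k => [|k IH] //=; exact: cT.
have step k x : `|u k.+1 x - u k x| <= c * 2^-1 ^+ k * phi x.
  elim: k x => [|k IH] x; first by rewrite mulr1; exact: T0.
  by rewrite exprSr mulrA; exact: (contr _ _ _ (cu k.+1) (cu k) IH).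
have [f fu] : exists f, forall x k, `|f x - u k x| <= 2 * c * 2^-1 ^+ k * phi x.
  have h x : exists l, forall k, `|l - u k x| <= 2 * (c * phi x) * 2^-1 ^+ k.
    apply: geometric_cauchy_cvg => k.
    by rewrite (le_trans (step k x))// mulrAC.
  exists (fun x => projT1 (cid (h x))) => x k.
  have := projT2 (cid (h x)) k; congr (_ <= _); ring.
have cf : continuous f.
  move=> x; apply/cvgrPdist_le => e e0.
  (* Near [x] the weight is at most [phi x + 1], so a single [k] controls the error at both [x] and
     [y], and the usual three-term estimate applies. *)
  have [k ke] : exists k, 2 * c * 2^-1 ^+ k * (phi x + 1) < e / 3.
    apply: contrapT => H.
    suff : e / 3 <= 0 by rewrite leNgt divr_gt0.
    apply: (@le0_of_le_geometric (2 * c * (phi x + 1))) => k.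
    rewrite leNgt; apply/negP => h; apply: H; exists k.
    by move: h; congr (_ < _); ring.
  have e3 : 0 < e / 3 by rewrite divr_gt0.
  have /cvgrPdist_le/(_ _ e3) nu := cu k x.
  have /cvgrPdist_le/(_ _ ltr01) nphi := cphi x.
  near=> y.
  have h1 := fu x k; have h2 := fu y k.
  have h3 : `|u k x - u k y| <= e / 3 by near: y; exact: nu.
  have h4 : `|phi x - phi y| <= 1 by near: y; exact: nphi.
  have c0 : 0 <= 2 * c * 2^-1 ^+ k.
    rewrite mulr_ge0 ?exprn_ge0 ?invr_ge0// mulr_ge0//.
    by rewrite -(pmulr_lge0 _ (phi0 0)) (le_trans _ (T0 0)).
  have h5 : 2 * c * 2^-1 ^+ k * phi x <= 2 * c * 2^-1 ^+ k * (phi x + 1).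
    by rewrite ler_wpM2l// lerDl.
  have h6 : 2 * c * 2^-1 ^+ k * phi y <= 2 * c * 2^-1 ^+ k * (phi x + 1).
    by rewrite ler_wpM2l//; move: h4; rewrite ler_norml; lra.
  move: h1 h2 h3.
  move=> /ler_normlP[h1 h1'] /ler_normlP[h2 h2'] /ler_normlP[h3 h3'].
  by apply/ler_normlP; split; lra.
exists f => // x; apply/eqP; rewrite -subr_eq0 -normr_le0.
(* [T f] and [f] both lie within [c * 2^-1 ^+ k * phi] of [u k.+1]: the former by contraction from
   [u k], the latter by the rate of convergence. *)
apply: (@le0_of_le_geometric (2 * c * phi x)) => k.
have h1 := fu x k.+1; have h2 := contr _ _ _ cf (cu k) (fun x => fu x k) x.
have := ler_distD (u k.+1 x) (T f x) (f x); move: h1 h2.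
rewrite /u /= -/(u k) [`|T (u k) x - _|]distrC exprS; lra.
Unshelve. all: by end_near. Qed.
End WeightedFixpoint.

(** * Global solution of the second-order equation *)

Section ODE.
Variable R : realType.
Implicit Types f g : R -> R.

Lemma has_deriv_expR : has_deriv (@expR R) (@expR R).
Proof. exact: is_derive_expR. Qed.

Lemma has_deriv_gauss (al : R) : has_deriv (fun x => expR (al * (x * x)))
  (fun x => 2 * al * x * expR (al * (x * x))).
Proof.
have di := @has_deriv_id R.
apply: has_deriv_eq (has_deriv_comp has_deriv_expR
  (has_derivM (has_deriv_cst al) (has_derivM di di))) _ _ => // x.
ring.
Qed.

Lemma gauss_ge1 (al x : R) : 0 <= al -> 1 <= expR (al * (x * x)).
Proof. by move=> al0; rewrite -expR0 ler_expR mulr_ge0// -expr2 sqr_ge0. Qed.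

(* With phi the weight, D is compared with m x phi and then x D / 2 - W, of
   derivative (x d - D) / 2, with m phi / (2 al). *)
Lemma weighted_estimate_ge0 (d D W : R -> R) (al m : R) : 0 < al ->
  has_deriv D d -> has_deriv W D -> D 0 = 0 -> W 0 = 0 ->
  (forall x, `|d x| <= m * expR (al * (x * x))) ->
  forall x, 0 <= x ->
  `|x / 2 * D x - W x| <= m / (2 * al) * expR (al * (x * x)).
Proof.
move=> al0 dD dW D0 W0 le.
have m0 : 0 <= m.
  by have := le 0; rewrite !mulr0 expR0 mulr1; exact: le_trans.
have di := @has_deriv_id R.
have dphi := has_deriv_gauss al.
pose phi x := expR (al * (x * x)).
have phi0 x : 0 <= phi x by exact: expR_ge0.
have leD x : 0 <= x -> `|D x| <= m * (x * phi x).
  move=> x0; have := has_deriv_norm_le dD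
    (has_derivM (has_deriv_cst m) (has_derivM di dphi)) _ x0.
  rewrite D0 mul0r mulr0 !subr0; apply => y y0.
  (* The derivative of [x * phi x] is [phi x] plus a term that is nonnegative for [al > 0], so it
     dominates [phi]. *)
  rewrite mul0r add0r mul1r (le_trans (le y))// ler_wpM2l// lerDl.
  by rewrite !mulr_ge0// ltW.
have dw : has_deriv (fun x => x / 2 * D x - W x)
    (fun x => (x * d x - D x) / 2).
  apply: has_deriv_eq (has_derivB (has_derivM
    (has_derivM di (has_deriv_cst 2^-1)) dD) dW) _ _ => // x.
  by field.
have dg : has_deriv (fun x => m / (2 * al) * phi x) (fun x => m * (x * phi x)).
  apply: has_deriv_eq
    (has_derivM (has_deriv_cst (m / (2 * al))) dphi) _ _ => // x.
  by rewrite /phi; field; rewrite gt_eqF.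
move=> x x0; have := has_deriv_norm_le dw dg _ x0.
rewrite D0 W0 mulr0 !subr0 => h; apply: (le_trans (h _)) => [y y0|].
  rewrite normrM [`|2^-1|]gtr0_norm ?invr_gt0// ler_pdivrMr//.
  apply: (le_trans (ler_normB _ _)); rewrite normrM [`|y|]ger0_norm//.
  have := ler_wpM2l y0 (le y); have := leD y y0; rewrite /phi; lra.
by rewrite gerBl mulr_ge0// divr_ge0// mulr_ge0// ltW.
Qed.

Lemma weighted_estimate (d D W : R -> R) (al m : R) : 0 < al ->
  has_deriv D d -> has_deriv W D -> D 0 = 0 -> W 0 = 0 ->
  (forall x, `|d x| <= m * expR (al * (x * x))) ->
  forall x, `|x / 2 * D x - W x| <= m / (2 * al) * expR (al * (x * x)).
Proof.
move=> al0 dD dW D0 W0 le x.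
have [x0|/ltW x0] := leP 0 x.
  exact: weighted_estimate_ge0 dD dW _ _ _ _ _.
(* The negative half-line follows by reflection: passing to [W (- x)], [- D (- x)] and [d (- x)]
   preserves the hypotheses and turns [x / 2 * D x - W x] into its value at [- x]. *)
have dN : has_deriv (fun x : R => - x) (fun=> -1).
  by move=> y; exact: is_derive_eq.
have dD' : has_deriv (fun x => - D (- x)) (fun x => d (- x)).
  apply: has_deriv_eq (has_deriv_comp dN (has_deriv_comp dD dN)) _ _ => // y.
  by ring.
have dW' : has_deriv (fun x => W (- x)) (fun x => - D (- x)).
  apply: has_deriv_eq (has_deriv_comp dW dN) _ _ => // y.
  by ring.
have := @weighted_estimate_ge0 _ _ _ al m al0 dD' dW' _ _ _ (- x).
rewrite !opprK oppr0 D0 oppr0 !mulNr !mulrN !opprK.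
apply => // [y|]; last by rewrite oppr_ge0.
by have := le (- y); rewrite mulrNN.
Qed.

Lemma ode_solution (G : R -> R) (L B : R) : 0 < L ->
  (forall s t, `|G s - G t| <= L * `|s - t|) -> (forall s, `|G s| <= B) ->
  exists u p, [/\ has_deriv u p,
    has_deriv p (fun x => G (x / 2 * p x - u x)), u 0 = 0 & p 0 = 1].
Proof.
move=> L0 GL GB.
have cG : continuous G.
  move=> s; apply/cvgrPdist_le => e e0.
  have eL : 0 < e / L by rewrite divr_gt0.
  have /cvgrPdist_le/(_ _ eL) := @cvg_id _ (nbhs s); apply: filterS => t h.
  by rewrite (le_trans (GL _ _))// mulrC -ler_pdivlMr.
(* The unknown [f] is the second derivative of the solution. [P f] and [U f] recover the first
   derivative and the solution with initial values 1 and 0, so a fixed point of [T] solves the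
   equation. *)
pose P f x := 1 + prim f x.
pose U f := prim (P f).
have dP f : continuous f -> has_deriv (P f) f.
  move=> cf; apply: has_deriv_eq
    (has_derivD (has_deriv_cst 1) (prim_deriv cf)) _ _ => // x.
  by rewrite add0r.
have cP f (cf : continuous f) : continuous (P f).
  exact: has_deriv_continuous (dP _ cf).
have dU f (cf : continuous f) : has_deriv (U f) (P f) by exact/prim_deriv/cP.
have cU f (cf : continuous f) : continuous (U f).
  exact: has_deriv_continuous (dU _ cf).
pose T f x := G (x / 2 * P f x - U f x).
have [|x|f cf|f g m cf cg le|||f cf fT] :=
    @weighted_fixpoint R (fun x => expR (L * (x * x))) T (fun=> 0) B.
- exact: has_deriv_continuous (has_deriv_gauss L).
- exact: expR_gt0.
- move=> x; apply: continuous_comp; last exact: cG.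
  apply: cvgB; last exact: cU.
  by apply: cvgM; [apply: cvgM; [exact: cvg_id|exact: cvg_cst]|exact: cP].
(* Taking the Lipschitz constant [L] as the exponent of the weight makes the contraction factor
   [L / (2 * L)], that is 1/2. *)
- move=> x; apply: (le_trans (GL _ _)).
  have := @weighted_estimate _ _ _ L m L0 (has_derivB (dP _ cf) (dP _ cg))
    (has_derivB (dU _ cf) (dU _ cg)) _ _ le x.
  rewrite /U !prim0 ?/P ?prim0 ?subrr//; try exact: cP.
  move=> /(_ erefl erefl) h.
  have -> : x / 2 * P f x - U f x - (x / 2 * P g x - U g x) =
      x / 2 * (P f x - P g x) - (U f x - U g x) by ring.
  apply: (le_trans (ler_wpM2l (ltW L0) h)).
  have -> : L * (m / (2 * L) * expR (L * (x * x))) =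
      m / 2 * expR (L * (x * x)) by field; rewrite gt_eqF.
  by [].
- exact: cst_continuous.
(* The first iterate from 0 is bounded by [B], and the weight is at least 1. *)
- have B0 : 0 <= B by exact: le_trans (normr_ge0 _) (GB 0).
  by move=> x; rewrite subr0 (le_trans (GB _))// ler_peMr// gauss_ge1// ltW.
exists (U f), (P f); split.
- exact: dU.
- by apply: has_deriv_eq (dP _ cf) _ _ => // x; rewrite -fT.
- exact/prim0/cP.
- by rewrite /P prim0// addr0.
Qed.

End ODE.

(** * Smoothness in one variable *)

(** An infinite chain of derivatives. The coinductive form lets a family of functions closed under
    differentiation be proved smooth all at once. *)
CoInductive smooth1 (R : realType) (f : R -> R) : Prop :=
  Smooth1 f' of has_deriv f f' & smooth1 f'.

Section Smooth1.
Variable R : realType.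
Implicit Types f g : R -> R.

(** The algebra of functions generated by [S] and the constants. *)
Inductive generated (S : (R -> R) -> Prop) : (R -> R) -> Prop :=
| GenBase f of S f : generated S f
| GenCst c : generated S (fun=> c)
| GenD f g of generated S f & generated S g : generated S (fun x => f x + g x)
| GenM f g of generated S f & generated S g : generated S (fun x => f x * g x).

(** By the sum and product rules the algebra is closed under differentiation as soon as its
    generators have derivatives in it. Corecursion then yields derivatives of every order. *)
Lemma generated_smooth1 (S : (R -> R) -> Prop) :
  (forall f, S f -> exists2 f', generated S f' & has_deriv f f') ->
  forall f, generated S f -> smooth1 f.
Proof.
move=> dS.
have dgen f : generated S f -> exists2 f', generated S f' & has_deriv f f'.
  elim=> {f} [f /dS//|c|f g _ [f' Sf df] _ [g' Sg dg]|
              f g Sf [f' Sf' df] Sg [g' Sg' dg]].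
  - by exists (fun=> 0); [exact: GenCst|exact: has_deriv_cst].
  - by exists (fun x => f' x + g' x); [exact: GenD|exact: has_derivD].
  - exists (fun x => f' x * g x + f x * g' x); last exact: has_derivM.
    by apply: GenD; exact: GenM.
by cofix IH => f /dgen[f' Sf' df]; apply: Smooth1 df (IH _ Sf').
Qed.

Lemma smooth1_cst (c : R) : smooth1 (fun=> c).
Proof.
by apply: (@generated_smooth1 (fun=> False)) => //; exact: GenCst.
Qed.

End Smooth1.

(** * The logistic function *)

Section Logistic.
Variables (R : realType) (k : R).

Definition logistic (s : R) : R := (1 + expR (- (k * s)))^-1.

Lemma logistic_den_gt0 s : 0 < 1 + expR (- (k * s)).
Proof. by rewrite ltr_wpDl// expR_gt0. Qed.

Lemma logistic_gt0 s : 0 < logistic s.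
Proof. by rewrite invr_gt0 logistic_den_gt0. Qed.

Lemma logistic_lt1 s : logistic s < 1.
Proof. by rewrite invf_lt1 ?logistic_den_gt0// ltrDl expR_gt0. Qed.

(** The logistic differential equation. Its right-hand side is a polynomial in [logistic], which
    later keeps a generated algebra closed under differentiation. *)
Lemma has_deriv_logistic :
  has_deriv logistic (fun s => k * (logistic s * (1 - logistic s))).
Proof.
have dN : has_deriv (fun s => - (k * s)) (fun=> - k).
  apply: has_deriv_eq (has_derivM (has_deriv_cst (- k)) (@has_deriv_id R)) _ _.
    by move=> s; rewrite mulNr.
  by move=> s; rewrite mul0r add0r mulr1.
have dE := has_derivD (has_deriv_cst 1)
  (has_deriv_comp (@has_deriv_expR R) dN).
move=> s; have := @is_deriveV _ (fun s => 1 + expR (- (k * s))) s _ _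
  (lt0r_neq0 (logistic_den_gt0 s)) (dE s).
move=> h; apply: is_derive_eq h _.
rewrite /logistic /GRing.scale /=; field.
by rewrite lt0r_neq0// logistic_den_gt0.
Qed.

(** The odds of the logistic function are [expR (k * s)]; this inverts the logarithm in the
    equation. *)
Lemma ln_logistic_odds s : ln (logistic s / (1 - logistic s)) = k * s.
Proof.
have -> : logistic s / (1 - logistic s) = expR (k * s).
  have := expRxMexpNx_1 (k * s).
  rewrite /logistic; have := expR_gt0 (- (k * s)).
  set e := expR (- _) => e0 h.
  have -> : expR (k * s) = e^-1.
    by rewrite -[LHS]mulr1 -(mulfV (lt0r_neq0 e0)) mulrA h mul1r.
  field; rewrite (lt0r_neq0 e0) /=.
  by rewrite lt0r_neq0// addr_gt0.
by rewrite expRK.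
Qed.

End Logistic.

(** * The one-dimensional solution *)

Lemma shrinker_profile (R : realType) (a b c : R) : 0 < b -> 0 < c ->
  exists u p q : R -> R,
    [/\ [/\ has_deriv u p, has_deriv p q, u 0 = 0 & p 0 = 1], smooth1 u,
        forall x, - (b + a) < q x < b - a &
        forall x, c * ln ((b + a + q x) / (b - a - q x)) = x / 2 * p x - u x].
Proof.
move=> b0 c0; pose k := c^-1; have k0 : 0 < k by rewrite invr_gt0.
(* [G s] is the root [y] of [c * ln ((b + a + y) / (b - a - y)) = s]: the numerator becomes
   [2 * b * logistic k s] and the denominator [2 * b * (1 - logistic k s)]. *)
pose G s := 2 * b * logistic k s - (b + a).
have dG : has_deriv G
    (fun s => 2 * b * (k * (logistic k s * (1 - logistic k s)))).
  apply: has_deriv_eq (has_derivB (has_derivM (has_deriv_cst (2 * b))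
    (@has_deriv_logistic R k)) (has_deriv_cst (b + a))) _ _ => // s.
  by rewrite mul0r add0r subr0.
have GL s : `|2 * b * (k * (logistic k s * (1 - logistic k s)))| <= 2 * b * k.
  have l0 := logistic_gt0 k s; have l1 := logistic_lt1 k s.
  have h : 0 <= logistic k s * (1 - logistic k s) <= 1.
    by apply/andP; split; nra.
  rewrite ger0_norm; last by rewrite !mulr_ge0//; lra.
  by rewrite mulrA ler_piMr ?mulr_ge0//; lra.
have GB s : `|G s| <= 2 * b + `|b + a|.
  have l0 := logistic_gt0 k s; have l1 := logistic_lt1 k s.
  apply: (le_trans (ler_normB _ _)); rewrite lerD2r.
  rewrite ger0_norm ?mulr_ge0//; try lra.
  by rewrite ler_piMr// ?mulr_ge0//; lra.
have L0 : 0 < 2 * b * k by rewrite !mulr_gt0.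
have [u [p [du dp u0 p0]]] := ode_solution L0 (lipschitz_of_deriv_le dG GL) GB.
exists u, p, (fun x => G (x / 2 * p x - u x)); split=> //.
- pose v x := logistic k (x / 2 * p x - u x).
  (* With [v] adjoined as a generator, the derivative of [p] is affine in [v], and that of [v] is
     polynomial in the four generators by the logistic equation. *)
  pose S f := [\/ f = id, f = u, f = p | f = v].
  have gi : generated S id by apply: GenBase; apply: Or41.
  have gu : generated S u by apply: GenBase; apply: Or42.
  have gp : generated S p by apply: GenBase; apply: Or43.
  have gv : generated S v by apply: GenBase; apply: Or44.
  have gC (d : R) : generated S (fun=> d) by exact: GenCst.
  have gq : generated S (fun x => 2 * b * v x + - (b + a)).
    by apply: GenD => //; exact: GenM.
  apply: (@generated_smooth1 R S) => // f [] ->.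
  + by exists (fun=> 1) => //; exact: has_deriv_id.
  + by exists p.
  + by exists (fun x => 2 * b * v x + - (b + a)).
  + have dw := has_derivB (has_derivM (has_derivM (@has_deriv_id R)
      (has_deriv_cst 2^-1)) dp) du.
    have dv := has_deriv_comp (@has_deriv_logistic R k) dw.
    (* The chain rule, with the derivative of [x / 2 * p x - u x] equal to half of [x * q x - p x].
       Differences are written with the factor -1 because [generated] has only sums and products. *)
    exists (fun x => k * (v x * (1 + -1 * v x)) *
       (2^-1 * (x * (2 * b * v x + - (b + a)) + -1 * p x))).
      by repeat (first [assumption|exact: gi|apply: GenD|apply: GenM]).
    apply: has_deriv_eq dv _ _ => // x; rewrite /v /G.
    by field.
- move=> x; set s := _ - u x.
  have l0 := logistic_gt0 k s; have l1 := logistic_lt1 k s.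
  by rewrite /G; apply/andP; split; nra.
- move=> x; set s := _ - u x.
  have l0 := logistic_gt0 k s; have l1 := logistic_lt1 k s.
  have -> : (b + a + G s) / (b - a - G s) = logistic k s / (1 - logistic k s).
    rewrite /G; field; apply/andP; split; first by lra.
    have -> : b - a - (2 * b * logistic k s - (b + a)) =
        2 * b * (1 - logistic k s) by ring.
    by rewrite !mulf_neq0//; lra.
  by rewrite ln_logistic_odds /k mulVKf// gt_eqF.
Qed.

(** * Sums of functions of one coordinate each *)

Section Separable.
Variables (R : realType) (n : nat).
Implicit Types F : 'I_n -> R -> R.

Definition separable F (x : 'rV[R]_n) : R := \sum_(i < n) F i (x 0 i).

(** Along ['e_i] all summands but the [i]-th cancel, so the difference quotient is that of [F i]. *)
Lemma is_derive_separable F F' (i : 'I_n) (x : 'rV[R]_n) :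
  (forall j, has_deriv (F j) (F' j)) ->
  is_derive x 'e_i (separable F) (F' i (x 0 i)).
Proof.
move=> dF; have [dFi <-] := dF i (x 0 i).
have e : (fun h : R => h^-1 *:
      ((separable F \o shift x) (h *: 'e_i) - separable F x)) =
    (fun h : R => h^-1 *: ((F i \o shift (x 0 i)) (h *: 1) - F i (x 0 i))).
  apply/funext => h; congr (_ *: _).
  rewrite /separable /= (bigD1 i)//= [in X in _ - X](bigD1 i)//= !mxE !eqxx /=.
  rewrite (eq_bigr (fun j => F j (x 0 j))); last first.
    by move=> j ji; rewrite !mxE (negPf ji) andbF mulr0 add0r.
  by rewrite opprD addrACA subrr addr0.
by split; rewrite /derivable /derive e.
Qed.

Lemma partial_separable F F' (i : 'I_n) :
  (forall j, has_deriv (F j) (F' j)) ->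
  partial i (separable F) = fun x => F' i (x 0 i).
Proof.
by move=> dF; apply/funext => x; have [_ <-] := is_derive_separable i x dF.
Qed.

(** Makes a partial derivative of a separable function separable again, so that differentiation can
    be iterated. *)
Lemma separable_single (f : R -> R) (i : 'I_n) :
  (fun x : 'rV[R]_n => f (x 0 i)) =
  separable (fun j => if j == i then f else fun=> 0).
Proof.
apply/funext => x; rewrite /separable (bigD1 i)//= eqxx big1 ?addr0// => j.
by move/negPf ->.
Qed.

Lemma continuous_separable F : (forall i, continuous (F i)) ->
  continuous (separable F).
Proof.
move=> cF; apply: continuous_big; first exact: add_continuous.
move=> i _ x; apply: (@continuous_comp _ _ _ (fun x : 'rV[R]_n => x 0 i)).
  exact: coord_continuous.
exact: cF.
Qed.

Lemma smooth_separable F : (forall i, smooth1 (F i)) -> smooth (separable F).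
Proof.
move=> sF s.
have [F' sF' ->] : exists2 F', (forall i, smooth1 (F' i)) &
    partials s (separable F) = separable F'.
  elim: s => [|i s [F' sF' IH]]; first by exists F.
  have /choice[F'' dF''] j : exists f', has_deriv (F' j) f' /\ smooth1 f'.
    by case: (sF' j) => f' ? ?; exists f'.
  exists (fun j => if j == i then F'' i else fun=> 0).
    move=> j; case: ifP => _; last exact: smooth1_cst.
    by have [] := dF'' i.
  rewrite /partials /= -/(partials s (separable F)) IH.
  by rewrite (partial_separable _ (fun j => (dF'' j).1)) separable_single.
have /choice[F'' dF''] j : exists f', has_deriv (F' j) f'.
  by case: (sF' j) => f' ? ?; exists f'.
split.
  by apply: continuous_separable => i; exact: has_deriv_continuous (dF'' i).
by move=> i x; have [] := is_derive_separable i x dF''.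
Qed.

Lemma gradient_separable F F' x : (forall j, has_deriv (F j) (F' j)) ->
  gradient (separable F) x = \row_i F' i (x 0 i).
Proof.
by move=> dF; apply/rowP => i; rewrite !mxE (partial_separable _ dF).
Qed.

Lemma hessian_separable F F' F'' x :
  (forall j, has_deriv (F j) (F' j)) -> (forall j, has_deriv (F' j) (F'' j)) ->
  hessian (separable F) x = diag_mx (\row_i F'' i (x 0 i)).
Proof.
move=> dF dF'; apply/matrixP => i j; rewrite !mxE (partial_separable _ dF).
rewrite separable_single.
rewrite (@partial_separable _ (fun k => if k == j then F'' j else fun=> 0)).
  by rewrite eq_sym; case: eqVneq => [->|].
by move=> k; case: ifP => _; [exact: dF'|exact: has_deriv_cst].
Qed.

End Separable.

(** * Diagonal forms, restriction to an axis, and the angle *)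

(** The difference of the forms is the sum of [(e 0 j - d 0 j) * v 0 j ^+ 2], which has a positive
    term at any nonzero coordinate of [v]. *)
Lemma qform_lt_diag (R : realType) (n : nat) (d e : 'rV[R]_n) :
  (forall i, d 0 i < e 0 i) -> qform_lt (diag_mx d) (diag_mx e).
Proof.
move=> lt v v0; rewrite -subr_gt0 /dotv -sumrB.
have [i vi] : exists i, v 0 i != 0.
  by apply/existsP; rewrite -negb_forall; apply: contra v0 => /forallP v0;
    apply/eqP/rowP => i; rewrite mxE; apply/eqP/v0.
have E j : (v *m diag_mx e) 0 j * v 0 j - (v *m diag_mx d) 0 j * v 0 j =
    (e 0 j - d 0 j) * v 0 j ^+ 2 by rewrite !mul_mx_diag !mxE; ring.
rewrite (bigD1 i)//= ltr_wpDr//.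
  by rewrite sumr_ge0// => j _; rewrite E mulr_ge0 ?sqr_ge0// subr_ge0 ltW.
by rewrite E mulr_gt0 ?subr_gt0// exprn_even_gt0.
Qed.

Lemma quadratic_polynomial_axis (R : realType) (n : nat) (u : 'rV[R]_n -> R)
    (i : 'I_n) : quadratic_polynomial u ->
  exists2 q : {poly R}, (size q <= 3)%N & forall t, u (t *: 'e_i) = q.[t].
Proof.
move=> [p p3 pu].
(* Substitutes 0 for every variable but the [i]-th. Since [0 ^+ 0 = 1], exactly the monomials in
   that variable alone survive. *)
exists (\sum_(m <- msupp p)
  (mcoeff m p * \prod_(j < n | j != i) 0 ^+ fun_of_multinom m j) *:
    'X^(fun_of_multinom m i)).
  apply: (leq_trans (size_sum _ _ _)).
  rewrite big_seq; apply/bigmax_leqP_seq => m mp _.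
  rewrite (leq_trans (size_scale_leq _ _))// size_polyXn.
  have mdegm : (mdeg m < mmeasure mdeg p)%N by exact: mmeasure_mnm_lt.
  rewrite (leq_trans _ p3)// (leq_ltn_trans _ mdegm)//.
  by rewrite mdegE (bigD1 i)//= leq_addr.
move=> t; rewrite pu mevalE horner_sum; apply: eq_bigr => m _.
rewrite hornerZ hornerXn (bigD1 i)//= !mxE !eqxx mulr1 [t ^+ _ * _]mulrC mulrA.
congr (_ * _ * _); apply: eq_bigr => j ji.
by rewrite !mxE (negPf ji) andbF mulr0.
Qed.

(** Equivalent to the positivity of cos² - sin², which is the cosine of [tau + tau], an angle
    between - pi/2 and 0. *)
Lemma cot_sqr_gt1 (R : realType) (tau : R) :
  - (pi / 4) < tau < 0 -> 1 < cot tau ^+ 2.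
Proof.
move=> /andP[t1 t0].
have s0 : sin tau != 0.
  rewrite -oppr_eq0 -sinN lt0r_neq0// sin_gt0_pi// oppr_gt0 t0 /=.
  by have := pi_gt0 R; lra.
rewrite /cot expr_div_n ltr_pdivlMr ?exprn_even_gt0// mul1r -subr_gt0.
have -> : cos tau ^+ 2 - sin tau ^+ 2 = cos (tau + tau) by rewrite cosD !expr2.
by apply: cos_gt0_pihalf; apply/andP; split; have := pi_gt0 R; lra.
Qed.

(** * The entire solution in dimension [n] *)

Theorem theorem1p6 (R : realType) (n : nat) (hn : (1 <= n)%N)
    (tau a b : R) (htau : - (pi / 4) < tau < 0)
    (ha : a = cot tau) (hb : b = Num.sqrt (cot tau ^+ 2 - 1)) :
  exists u : 'rV[R]_n -> R,
    [/\ smooth u, ~ quadratic_polynomial u, admissible a b u & solves a b u].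
Proof.
have b0 : 0 < b by rewrite hb sqrtr_gt0 subr_gt0 cot_sqr_gt1.
pose c := Num.sqrt (a ^+ 2 + 1) / (2 * b).
have c0 : 0 < c by rewrite divr_gt0 ?mulr_gt0// sqrtr_gt0 ltr_wpDl ?sqr_ge0.
have [v [p [q [[dv dp v0 p0] sv qab qE]]]] := shrinker_profile a b0 c0.
exists (separable (fun=> v)).
have H x := @hessian_separable R n (fun=> v) (fun=> p) (fun=> q) x
  (fun=> dv) (fun=> dp).
split.
- by apply: smooth_separable.
- move=> /(@quadratic_polynomial_axis _ _ _ (Ordinal hn))[r r3 rE].
  have vr t : v t = r.[t].
    rewrite -rE /separable (bigD1 (Ordinal hn))//= !mxE !eqxx mulr1.
    rewrite big1 ?addr0// => j ji.
    by rewrite !mxE (negPf ji) andbF mulr0.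
  have pr t : p t = r^`().[t].
    apply: (has_deriv_unique dv) => x; rewrite (funext vr).
    exact: is_derive_poly.
  have qr t : q t = r^`()^`().[t].
    apply: (has_deriv_unique dp) => x; rewrite (funext pr).
    exact: is_derive_poly.
  (* Each derivative lowers the size by at least one until it reaches 0, so from size at most 3 a
     constant remains. *)
  have [d rd] : exists d, r^`()^`() = d%:P.
    exists (r^`()^`())`_0; apply: size1_polyC.
    rewrite (leq_trans (size_poly _ _))// -subn1 leq_subLR.
    by rewrite (leq_trans (size_poly _ _))// -subn1 leq_subLR.
  (* By the equation this expression depends on [x] only through [q x], which is now constant; its
     value at 0 is [- v 0 = 0]. *)
  have cst x : x / 2 * p x - v x = 0.
    transitivity (0 / 2 * p 0 - v 0); last by rewrite v0 !mul0r subr0.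
    by rewrite -!qE !qr rd !hornerC.
  have dw := has_derivB (has_derivM (has_derivM (@has_deriv_id R)
      (has_deriv_cst 2^-1)) dp) dv.
  have d0 := has_deriv_eq dw cst (fun=> erefl).
  have := has_deriv_unique d0 (has_deriv_cst 0) 0.
  (* At 0 the derivative is [p 0 / 2 - p 0], that is -1/2, whereas a constant has derivative 0. *)
  by rewrite p0; lra.
- move=> x; rewrite H -!diag_const_mx.
  by split; apply: qform_lt_diag => i; rewrite !mxE;
    have /andP[] := qab (x 0 i).
(* The Hessian is diagonal with entries [q (x 0 i)], so these are the eigenvalues and the equation
   splits into [n] copies of the one-dimensional one. *)
- move=> x; exists (fun i => q (x 0 i)).
    rewrite /eigenvalues_of H char_poly_trig ?diag_mx_is_trig//.
    by apply: eq_bigr => i _; rewrite !mxE eqxx.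
  rewrite (@gradient_separable _ _ _ (fun=> p))// /separable /dotv.
  rewrite -/c !mulr_sumr -sumrN -big_split /=; apply: eq_bigr => i _.
  by rewrite qE !mxE; ring.
Qed.
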